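(* Let $i,j,k$ be integers with $3\le i\le j\le k$ and $k\ge 5$. Suppose that $p_i+p_j+p_k$ is universal over $\mathbb{N}$. Then $(i,j,k)$ is among the following $31$ triples: $$(3,3,5),\ (3,3,6),\ (3,3,7),\ (3,3,8),\ (3,3,10),\ (3,3,12),\ (3,3,17),$$ $$(3,4,5),\ (3,4,6),\ (3,4,7),\ (3,4,8),\ (3,4,9),\ (3,4,10),\ (3,4,11),$$ $$(3,4,12),\ (3,4,13),\ (3,4,15),\ (3,4,17),\ (3,4,18),\ (3,4,27),$$ $$(3,5,5),\ (3,5,6),\ (3,5,7),\ (3,5,8),\ (3,5,9),\ (3,5,11),\ (3,5,13),$$ $$(3,7,8),\ (3,7,10),\ (4,4,5),\ (4,5,6).$$
   Context: $\mathbb{N}=\{0,1,2,\ldots\}$. For an integer $m\ge 3$ and $x\in\mathbb{N}$, $p_m(x)=\frac{(m-2)x^2-(m-4)x}{2}$. For positive integers $a,b,c$ and integers $i,j,k\ge 3$, the sum $ap_i+bp_j+cp_k$ is called universal over $\mathbb{N}$ if every $n\in\mathbb{N}$ can be written as $n=ap_i(x)+bp_j(y)+cp_k(z)$ with $x,y,z\in\mathbb{N}$. *)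

(* Defs.v *)
From Stdlib Require Import ZArith List Lia.
Open Scope Z_scope.

(* Z.div is floor division; [polygonal_double] shows that it is exact here. *)
Definition polygonal (m : Z) (x : nat) : Z :=
  ((m - 2) * (Z.of_nat x) ^ 2 - (m - 4) * Z.of_nat x) / 2.

Lemma polygonal_double (m : Z) (x : nat) :
  2 * polygonal m x = (m - 2) * (Z.of_nat x) ^ 2 - (m - 4) * Z.of_nat x.
Proof.
  unfold polygonal; set (t := Z.of_nat x).
  symmetry; apply Z.div_exact; [lia|].
  destruct (Z.Even_or_Odd t) as [[s ->]|[s ->]].
  - replace (_ - _) with (((m - 2) * (2 * s ^ 2) - (m - 4) * s) * 2) by ring.
    apply Z.mod_mul; lia.
  - replace (_ - _) with
      (((m - 2) * (2 * s ^ 2 + 2 * s) - (m - 4) * s + 1) * 2) by ring.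
    apply Z.mod_mul; lia.
Qed.

(* a p_i + b p_j + c p_k is universal over N; meant for a, b, c >= 1 and
   i, j, k >= 3. *)
Definition universal_sum (a b c i j k : Z) : Prop :=
  forall n : nat, exists x y z : nat,
    Z.of_nat n = a * polygonal i x + b * polygonal j y + c * polygonal k z.

(* Main.v *)
(** Since [polygonal m] takes the values [0], [1], [m], ... in increasing order,
    the numbers at most [n] that it takes do not change when [m > n] is replaced
    by [n + 1].  Hence a single missed [n] disposes of all large parameters at
    once: the number 4 forces [i <= 4], then 9 (for [i = 3]) and 7 (for [i = 4])
    force [j <= 9], and the numbers at most 34 force [k <= 34].  Of the finitely
    many triples that remain, each one not listed misses some [n <= 468]
    (the extreme case is [(3, 4, 20)]). *)

Require Import Defs.
From Stdlib Require Import ZArith List.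
From Stdlib Require Import Bool Lia.
Import ListNotations.
Open Scope Z_scope.

Lemma polygonal_0 (m : Z) : polygonal m 0 = 0.
Proof. pose proof (polygonal_double m 0); lia. Qed.

Lemma polygonal_1 (m : Z) : polygonal m 1 = 1.
Proof. pose proof (polygonal_double m 1); lia. Qed.

(** The difference of the two sides is [(m - 3) x (x - 1) + x]. This bounds the arguments [x] to be
    searched and shows that values are nonnegative. *)
Lemma polygonal_ge_square (m : Z) (x : nat) :
  3 <= m -> Z.of_nat x * Z.of_nat x <= 2 * polygonal m x.
Proof.
  intros Hm; rewrite polygonal_double.
  assert (0 <= (m - 3) * (Z.of_nat x * (Z.of_nat x - 1)))
    by (apply Z.mul_nonneg_nonneg; [lia|]; destruct x; nia).
  lia.
Qed.

Lemma polygonal_ge_order (m : Z) (x : nat) :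
  3 <= m -> (2 <= x)%nat -> m <= polygonal m x.
Proof.
  intros Hm Hx; pose proof (polygonal_double m x) as E.
  assert (0 <= (m - 2) * ((Z.of_nat x - 2) * (Z.of_nat x + 1)))
    by (repeat apply Z.mul_nonneg_nonneg; lia).
  lia.
Qed.

(** If [m > n], a value at most [n] can only come from [x = 0] or [x = 1], where it does not depend
    on [m]. *)
Lemma polygonal_cap (m n : Z) (x : nat) :
  3 <= m -> polygonal m x <= n -> polygonal (Z.min m (n + 1)) x = polygonal m x.
Proof.
  intros Hm Hn.
  destruct (Z.min_spec m (n + 1)) as [[_ ->]|[Hle ->]]; [reflexivity|].
  destruct x as [|[|x]].
  - now rewrite !polygonal_0.
  - now rewrite !polygonal_1.
  - pose proof (polygonal_ge_order m (S (S x)) Hm ltac:(lia)); lia.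
Qed.

Definition range (a : Z) (len : nat) : list Z :=
  map (fun t => a + Z.of_nat t) (seq 0 len).

Lemma in_range (a b : Z) (len : nat) :
  a <= b < a + Z.of_nat len -> In b (range a len).
Proof.
  intros H; apply in_map_iff; exists (Z.to_nat (b - a)).
  split; [lia|apply in_seq; lia].
Qed.

(** Arguments up to [sqrt (2 n)] suffice, since [x ^ 2] is at most twice the value. *)
Definition values (m n : Z) : list Z :=
  filter (fun v => v <=? n)
    (map (polygonal m) (seq 0 (S (Z.to_nat (Z.sqrt (2 * n)))))).

Lemma in_values (m n : Z) (x : nat) :
  3 <= m -> polygonal m x <= n ->
  In (polygonal m x) (values (Z.min m (n + 1)) n).
Proof.
  intros Hm Hn; apply filter_In; split; [|now apply Z.leb_le].
  rewrite <- (polygonal_cap m n x Hm Hn); apply in_map, in_seq.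
  pose proof (polygonal_ge_square m x Hm).
  assert (Z.of_nat x <= Z.sqrt (2 * n)) by (apply Z.sqrt_le_square; lia).
  lia.
Qed.

Definition represents (t : Z * Z * Z) (n : Z) : bool :=
  let '(i, j, k) := t in
  let vj := values j n in
  let vk := values k n in
  existsb (fun a => existsb (fun b => existsb (Z.eqb (n - a - b)) vk) vj)
    (values i n).

Lemma universal_represents (i j k n : Z) :
  3 <= i -> 3 <= j -> 3 <= k -> universal_sum 1 1 1 i j k -> 0 <= n ->
  represents (Z.min i (n + 1), Z.min j (n + 1), Z.min k (n + 1)) n = true.
Proof.
  intros Hi Hj Hk U Hn.
  destruct (U (Z.to_nat n)) as (x & y & z & E).
  (* All three summands are nonnegative, so each is at most [n]. *)
  pose proof (polygonal_ge_square i x Hi).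
  pose proof (polygonal_ge_square j y Hj).
  pose proof (polygonal_ge_square k z Hk).
  apply existsb_exists; exists (polygonal i x); split; [apply in_values; lia|].
  apply existsb_exists; exists (polygonal j y); split; [apply in_values; lia|].
  apply existsb_exists; exists (polygonal k z); split; [apply in_values; lia|].
  apply Z.eqb_eq; lia.
Qed.

Definition candidates (ks : list Z) : list (Z * Z * Z) :=
  filter (fun t => let '(i, j, k) := t in (i <=? j) && (j <=? k))
    (list_prod (list_prod (range 3 2) (range 3 7)) ks).

Lemma in_candidates (i j k : Z) (ks : list Z) :
  3 <= i <= 4 -> i <= j <= 9 -> j <= k -> In k ks -> In (i, j, k) (candidates ks).
Proof.
  intros Hi Hj Hjk Hk; apply filter_In; split.
  - repeat apply in_prod; try apply in_range; simpl; auto; lia.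
  - apply andb_true_intro; split; apply Z.leb_le; lia.
Qed.

Definition survivors (ns ks : list Z) : list (Z * Z * Z) :=
  filter
    (fun t => let '(i, j, k) := t in
      forallb
        (fun n => represents (Z.min i (n + 1), Z.min j (n + 1), Z.min k (n + 1)) n)
        ns)
    (candidates ks).

Lemma first_order_le (i j k : Z) :
  3 <= i <= j -> j <= k -> universal_sum 1 1 1 i j k -> i <= 4.
Proof.
  intros Hi Hk U; apply Z.nlt_ge; intros H.
  pose proof (universal_represents i j k 4 ltac:(lia) ltac:(lia) ltac:(lia) U
    ltac:(lia)) as R.
  (* All orders are capped to 5; the values up to 4 are then 0 and 1, with sums at most 3. *)
  rewrite !Z.min_r in R by lia; vm_compute in R; discriminate.
Qed.

Lemma second_order_le (i j k : Z) :
  3 <= i <= j -> j <= k -> universal_sum 1 1 1 i j k -> j <= 9.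
Proof.
  intros Hi Hk U; apply Z.nlt_ge; intros H.
  pose proof (first_order_le i j k Hi Hk U).
  pose proof (fun n => universal_represents i j k n ltac:(lia) ltac:(lia)
    ltac:(lia) U) as R.
  assert (i = 3 \/ i = 4) as [-> | ->] by lia.
  (* The last two terms add at most 2, and none of 7, 8, 9 is triangular. *)
  - specialize (R 9 ltac:(lia)).
    rewrite (Z.min_r j), (Z.min_r k) in R by lia; vm_compute in R; discriminate.
  (* Likewise, none of 5, 6, 7 is a square. *)
  - specialize (R 7 ltac:(lia)).
    rewrite (Z.min_r j), (Z.min_r k) in R by lia; vm_compute in R; discriminate.
Qed.

(** Here [l] stands in for [k]: the tests on [ns] see only capped orders, so one [l] can represent
    infinitely many [k]. *)
Lemma in_survivors (i j k l : Z) (ns ks : list Z) :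
  3 <= i <= j -> j <= k -> j <= l -> universal_sum 1 1 1 i j k -> In l ks ->
  Forall (fun n => 0 <= n /\ Z.min l (n + 1) = Z.min k (n + 1)) ns ->
  In (i, j, l) (survivors ns ks).
Proof.
  intros Hi Hk Hl U Hks Hns.
  pose proof (first_order_le i j k Hi Hk U).
  pose proof (second_order_le i j k Hi Hk U).
  apply filter_In; split; [apply in_candidates; auto; lia|].
  apply forallb_forall; intros n Hn.
  rewrite Forall_forall in Hns; destruct (Hns n Hn) as [Hn0 ->].
  apply universal_represents; auto; lia.
Qed.

Lemma third_order_le (i j k : Z) :
  3 <= i <= j -> j <= k -> universal_sum 1 1 1 i j k -> k <= 34.
Proof.
  intros Hi Hk U; apply Z.nlt_ge; intros H.
  pose proof (second_order_le i j k Hi Hk U).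
  (* All tested numbers are at most 34, so 35 represents every [k >= 35]. *)
  assert (E : survivors [7; 8; 12; 13; 14; 26; 31; 33; 34] [35] = [])
    by (vm_compute; reflexivity).
  apply (@in_nil _ (i, j, 35)); rewrite <- E.
  apply (in_survivors i j k 35); simpl; auto; try lia.
  repeat constructor; lia.
Qed.

(** Each nonuniversal sum with [k <= 34] misses one of these numbers; they come
    from a greedy hitting-set search, those missed most often first. *)
Definition witnesses : list Z :=
  [ 14; 7; 20; 48; 33; 31; 41; 63; 69; 34; 42; 168; 65; 27; 32; 53; 12; 51; 60;
    75; 84; 90; 131; 15; 19; 24; 26; 43; 77; 82; 86; 99; 104; 112; 125; 129; 135;
    218; 398; 412; 413; 438; 468 ].

Theorem theorem1p9 (i j k : Z)
  (h3i : 3 <= i) (hij : i <= j) (hjk : j <= k) (h5k : 5 <= k)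
  (huniv : universal_sum 1 1 1 i j k) :
  In (i, j, k)
    [ (3,3,5); (3,3,6); (3,3,7); (3,3,8); (3,3,10); (3,3,12); (3,3,17);
      (3,4,5); (3,4,6); (3,4,7); (3,4,8); (3,4,9); (3,4,10); (3,4,11);
      (3,4,12); (3,4,13); (3,4,15); (3,4,17); (3,4,18); (3,4,27);
      (3,5,5); (3,5,6); (3,5,7); (3,5,8); (3,5,9); (3,5,11); (3,5,13);
      (3,7,8); (3,7,10); (4,4,5); (4,5,6) ].
Proof.
  pose proof (third_order_le i j k ltac:(lia) hjk huniv).
  (* [range 5 30] is 5, ..., 34. The candidates come in lexicographic order, as does the stated
     list, so the two lists are literally equal. *)
  match goal with |- In _ ?l =>
    assert (E : survivors witnesses (range 5 30) = l) by (vm_compute; reflexivity)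
  end.
  rewrite <- E; apply (in_survivors i j k k); auto; try lia.
  - apply in_range; lia.
  - repeat constructor; lia.
Qed.
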